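(* Let $p\ge2$ be an integer. Every planar graph with girth at least $5p-4$ is $p$-path degenerate, and there exists a planar graph with girth $5p-5$ that is not $p$-path degenerate.
   Context: Graphs are finite and simple; the girth is the length of a shortest cycle ($+\infty$ for forests). A strict ear of a graph $G$ is a path of $G$ whose internal vertices all have degree $2$ in $G$ and whose two endpoints are distinct. For an integer $p\ge1$, a $p$-reduction of $G$ is the deletion of either an isolated vertex, or a vertex of degree $1$, or the internal vertices of a strict ear of $G$ of length at least $p$. A graph is $p$-path degenerate if it can be reduced to the empty graph by a sequence of $p$-reductions. *)

(* Defs.v *)
From mathcomp Require Import all_boot.
Set Implicit Arguments. Unset Strict Implicit. Unset Printing Implicit Defensive.

Section Graphs.
Variables (T : finType) (e : rel T).

Definition simple_graph : Prop := symmetric e /\ irreflexive e.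

Definition is_graph_cycle (s : seq T) : bool :=
  [&& 3 <= size s, uniq s & cycle e s].

(* girth(G) >= g  (vacuous for forests, whose girth is +oo) *)
Definition girth_ge (g : nat) : Prop :=
  forall s, is_graph_cycle s -> g <= size s.

Definition girth_eq (g : nat) : Prop :=
  girth_ge g /\ exists s, is_graph_cycle s /\ size s = g.

(* The current graph is the induced subgraph G[S]. *)
Definition deg_in (S : {set T}) (x : T) : nat := #|[set y in S | e x y]|.

Definition p_reduction (p : nat) (S S' : {set T}) : Prop :=
  (exists2 x, x \in S & deg_in S x <= 1 /\ S' = S :\ x)
  \/
  (* deletion of the internal vertices [mid] of a strict ear
     x - mid - y of G[S] of length (size mid).+1 >= p *)
  (exists (x y : T) (mid : seq T),
     [/\ uniq (x :: rcons mid y),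
         path e x (rcons mid y),
         all (fun v => v \in S) (x :: rcons mid y),
         all (fun v => deg_in S v == 2) mid
       & p <= (size mid).+1]
     /\ S' = S :\: [set v in mid]).

Inductive p_reducible (p : nat) : {set T} -> Prop :=
  | p_red_empty : p_reducible p set0
  | p_red_step S S' : p_reduction p S S' -> p_reducible p S' -> p_reducible p S.

Definition path_degenerate (p : nat) : Prop := p_reducible p [set: T].

Definition is_dart (d : T * T) : bool := e d.1 d.2.
Definition darts : {set T * T} := [set d | is_dart d].

Definition rotation_system (rho : T * T -> T * T) : Prop :=
  [/\ forall d, is_dart d -> is_dart (rho d) /\ (rho d).1 = d.1,
      {in darts &, injective rho}
    & forall d d', is_dart d -> is_dart d' -> d.1 = d'.1 -> fconnect rho d d'].

Definition face_perm (rho : T * T -> T * T) (d : T * T) : T * T :=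
  rho (d.2, d.1).

Definition n_faces (rho : T * T -> T * T) : nat :=
  #|[set [set d' | fconnect (face_perm rho) d d'] | d in darts]|.

Definition n_components : nat := #|[set [set y | connect e x y] | x : T]|.
Definition n_isolated : nat := #|[set x : T | [forall y, ~~ e x y]]|.

(* Euler's formula for each component (genus 0):
     V - E + F + (#isolated vertices) = 2 * (#components),
   where E = #darts / 2; written multiplied by 2 to stay in nat. *)
Definition planar : Prop :=
  exists rho : T * T -> T * T,
    rotation_system rho /\
    2 * (#|T| + n_faces rho + n_isolated) = 4 * n_components + #|darts|.

End Graphs.

(* Main.v *)
Require Import Defs.
From mathcomp Require Import all_boot.
From mathcomp Require Import all_fingroup zify.
From Stdlib Require Import Classical.
Set Implicit Arguments. Unset Strict Implicit. Unset Printing Implicit Defensive.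

(** Upper bound: if no reduction applies to a nonempty G[S], then all degrees in
G[S] are at least 2 and among any p-1 consecutive vertices of a nonbacktracking
walk one has degree at least 3; as walks shorter than the girth do not repeat
vertices, every face of G[S] has at least 6 corners at vertices of degree at
least 3, which contradicts Euler's formula. That Euler's formula survives (as an
inequality) the passage from G to G[S] is shown by cutting edges one at a time
into pairs of half-edges: each cut multiplies the face permutation by a
transposition, so it changes the number of faces by exactly one.

Sharpness: the dodecahedron with every edge replaced by a path of length p-1. *)

(** The bound is 5p-4 = 5(p-1)+1. From a corner of degree at least 3, the start and the next 5(p-1)
    vertices of the walk are pairwise distinct, and the latter split into five blocks of p-1
    vertices, each containing a vertex of degree at least 3. Let G[S] have n2 vertices of degree 2,
    n3 of larger degree, a3 darts leaving the latter, and F faces. Euler's formula gives 4 + 2 n2 +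
    a3 <= 2 (n2 + n3) + 2 F, whereas 3 n3 <= a3 and 6 F <= a3 bound the right side by 2 n2 + a3.
    Cubic branch vertices with five of them per face are possible on the sphere, and this is what
    the dodecahedron realises, at girth 5(p-1). Planarity is given by one rotation system of the
    whole graph. Erasing darts would require a new rotation at each deletion; with half-edges [rho]
    stays fixed and only the edge involution changes. A vertex outside S that had darts keeps one
    orbit of half-edges and forms one component, so its contributions to the two sides of Euler's
    formula cancel. *)

(** * Components after removal of one edge *)

Section Components.
Variables (T : finType) (e1 e2 : rel T) (u v : T).
Hypotheses (sym1 : symmetric e1) (sym2 : symmetric e2) (sub12 : subrel e1 e2).
Hypothesis sub21 : forall x y, e2 x y ->
  e1 x y \/ (x, y) = (u, v) \/ (x, y) = (v, u).

Let connect12 x y : connect e1 x y -> connect e2 x y.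
Proof. by apply: connect_sub x y => x y /sub12/connect1. Qed.

(** Follow the walk up to the first use of the removed edge. *)
Lemma connect_delete_edge x y : connect e2 x y ->
  [\/ connect e1 x y, connect e1 x u | connect e1 x v].
Proof.
case/connectP => q; elim: q x => [x _ ->|z q IHq x /= /andP[xz zq] yE].
  exact: Or31.
case: (sub21 xz) => [/connect1 xz1|[[-> _]|[-> _]]].
- by case: (IHq z zq yE) => /(connect_trans xz1); constructor.
- exact: Or32.
- exact: Or33.
Qed.

Lemma n_components_delete_bridge : e2 u v ->
  n_components e1 <= (n_components e2).+1.
Proof.
move=> uv; rewrite /n_components.
set cl1 := fun x => [set y | connect e1 x y].
set cl2 := fun x => [set y | connect e2 x y].
have clE x y : connect e1 x y -> cl1 x = cl1 y.
  move=> xy; apply/setP => z; rewrite !inE.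
  exact: (same_connect (sym_connect_sym sym1) xy).
pose h (Q : {set T}) := if u \in Q then cl1 u else Q.
(* Only the class containing [u] can split; [h] sends it to the part of [u] and keeps the others, so
   at most the part of [v] is missed. *)
have sub : (cl1 @: [set: T]) :\ cl1 v \subset h @: (cl2 @: [set: T]).
  apply/subsetP => P; rewrite inE => /andP[Pv /imsetP[x _ PE]].
  apply/imsetP; exists (cl2 x); first exact: imset_f.
  rewrite PE /h inE; case: ifP => [xu|/negP xu].
    case: (connect_delete_edge xu) => /clE // xv.
    by case/negP: Pv; rewrite inE PE xv.
  apply/setP => y; rewrite !inE; apply/idP/idP => [/connect12 //|xy].
  case: (connect_delete_edge xy) => // /connect12 xw; case: xu => //.
  by apply: connect_trans xw _; apply: connect1; rewrite sym2.
have := subset_leq_card sub.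
have := leq_imset_card h (cl2 @: [set: T]).
have := cardsD1 (cl1 v) (cl1 @: [set: T]).
have -> : [set cl1 x | x : T] = cl1 @: [set: T].
  by apply/setP=> P; apply/imsetP/imsetP => -[x _ ->]; exists x; rewrite ?inE.
have -> : [set cl2 x | x : T] = cl2 @: [set: T].
  by apply/setP=> P; apply/imsetP/imsetP => -[x _ ->]; exists x; rewrite ?inE.
lia.
Qed.

(** Each use of the removed edge can be replaced by a detour, so reachability is unchanged. *)
Lemma n_components_delete_nonbridge : connect e1 u v ->
  n_components e1 <= n_components e2.
Proof.
move=> uv.
have csym1 := sym_connect_sym sym1.
suff c12 : connect e1 =2 connect e2.
  suff clE : (fun x => [set y | connect e1 x y]) =1 fun x => [set y | connect e2 x y].
    by rewrite /n_components (eq_imset _ clE).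
  by move=> x; apply/setP => y; rewrite !inE c12.
move=> x y; apply/idP/idP => [/connect12//|]; apply: connect_sub x y => x y.
case/sub21 => [/connect1 //|[[-> ->]//|[-> ->]]].
by rewrite csym1.
Qed.

End Components.

(** * Nonbacktracking walks and the girth *)

Section NonBacktracking.
Variables (T : finType) (e : rel T).
Hypotheses (irr : irreflexive e).

Lemma path_map_iota (w : nat -> T) k n :
  (forall i, e (w i) (w i.+1)) -> path e (w k) (map w (iota k.+1 n)).
Proof. by move=> wE; elim: n k => //= n IHn k; rewrite wE IHn. Qed.

Lemma cycle_mkseq (w : nat -> T) m :
  (forall i, e (w i) (w i.+1)) -> w 0 = w m.+1 -> path.cycle e (mkseq w m.+1).
Proof.
move=> wE w0; rewrite /mkseq /= w0 -cats1 -[[:: _]]/(map w (iota (1 + m) 1)).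
by rewrite -map_cat -iotaD -w0 path_map_iota.
Qed.

(** A repetition with least gap closes a cycle: gaps 1 and 2 are excluded by irreflexivity and by
    the absence of backtracking, and induction on the gap makes the vertices in between distinct. *)
Lemma nonbacktracking_inj (g : nat) (w : nat -> T) :
  girth_ge e g -> (forall i, e (w i) (w i.+1)) ->
  (forall i, w i != w i.+2) ->
  forall i j, i < j -> j - i < g -> w i != w j.
Proof.
move=> girth wE wN i j.
move: {2}(j - i) (leqnn (j - i)) => n; elim: n i j => [|n IHn] i j jn ij jg.
  lia.
apply/eqP => wij.
have /andP[ji1 ji2] : (j != i.+1) && (j != i.+2).
  apply/andP; split; apply/eqP => ji.
    by move: (wE i); rewrite -ji -wij irr.
  by move: (wN i); rewrite -ji -wij eqxx.
have size_s : size (mkseq (fun k => w (i + k)) (j - i)) = j - i.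
  by rewrite size_mkseq.
have : is_graph_cycle e (mkseq (fun k => w (i + k)) (j - i)).
  apply/and3P; split; first by rewrite size_s; lia.
    apply/mkseq_uniqP => a b; rewrite !inE => aj bj.
    case: (ltngtP a b) => // ab /eqP; last rewrite eq_sym;
      by rewrite (negPf (IHn _ _ _ _ _)) //; lia.
  have [m mE] : exists m, j - i = m.+1 by exists (j - i).-1; lia.
  rewrite mE; apply: cycle_mkseq => [k|]; first by rewrite addnS.
  by rewrite addn0 wij; congr w; lia.
by move/girth; rewrite size_s; lia.
Qed.

End NonBacktracking.

(** * Euler's inequality under the cutting of edges *)

Section PlanarDeletion.
Variables (T : finType) (e : rel T) (rho : T * T -> T * T).
Hypotheses (sym : symmetric e) (irr : irreflexive e).
Hypothesis rot : rotation_system e rho.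
Implicit Types (A B : {set T * T}) (d : T * T).

Local Notation D := (darts e).

Definition rev_dart d := (d.2, d.1).

Lemma rev_dartK : involutive rev_dart. Proof. by case. Qed.

Lemma rho_dart d : d \in D -> rho d \in D.
Proof. by case: rot => h _ _; rewrite !inE => /h[]. Qed.

Lemma rho_fst d : d \in D -> (rho d).1 = d.1.
Proof. by case: rot => h _ _; rewrite inE => /h[]. Qed.

Lemma rev_dart_in d : (rev_dart d \in D) = (d \in D).
Proof. by rewrite !inE /is_dart sym. Qed.

(* The darts outside [A] are kept as half-edges, i.e. fixed by the edge
   involution. Since [face_step A] is made the identity off [darts e], it is a
   permutation of [T * T] with #|~: darts e| extra orbits. *)
Definition face_step A d :=
  let c := if d \in A then rev_dart d else d in
  if c \in D then rho c else c.

Definition dart_rel A : rel T := fun x y => (x, y) \in A.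

Definition rev_closed A := forall d, d \in A -> rev_dart d \in A.

(** Twice the inequality V - E + F + (isolated vertices) >= 2c, where [2 * #|~: D|] offsets the
    fixed points of [s] off the darts. A vertex whose darts are all cut has the orbit of its
    half-edges as a face, so the isolated vertices to be added remain those of [e]. *)
Definition euler_bound A := exists2 s : {perm T * T}, s =1 face_step A &
  4 * n_components (dart_rel A) + #|A| + 2 * #|~: D|
    <= 2 * (#|T| + #|porbits s| + n_isolated e).

Lemma face_step_kept A d : d \in A -> d \in D ->
  face_step A d = rho (rev_dart d).
Proof. by rewrite /face_step => ->; rewrite rev_dart_in => ->. Qed.

Lemma face_step_cut A d : d \notin A -> d \in D -> face_step A d = rho d.
Proof. by rewrite /face_step => /negPf -> ->. Qed.

Lemma face_step_fst A d : d \in D ->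
  (face_step A d).1 = if d \in A then d.2 else d.1.
Proof.
move=> dD; case: ifPn => dA; first by rewrite face_step_kept // rho_fst ?rev_dart_in.
by rewrite face_step_cut // rho_fst.
Qed.

Lemma face_step_inj A : A \subset D -> rev_closed A -> injective (face_step A).
Proof.
move=> sAD revA.
have inj1 : injective (fun c => if c \in D then rho c else c).
  case: rot => _ rinj _ c c' /=.
  case: ifP => cD; case: ifP => cD' //; first exact: rinj.
    by move=> E; rewrite -E rho_dart in cD'.
  by move=> E; rewrite E rho_dart in cD.
have inj2 : injective (fun d => if d \in A then rev_dart d else d).
  move=> d d'; case: ifP => dA; case: ifP => dA' //.
  - exact: (can_inj rev_dartK).
  - by move=> E; rewrite -E revA in dA'.
  - by move=> E; rewrite E revA in dA.
exact: inj_comp inj1 inj2.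
Qed.

Lemma fconnect_porbit (U : finType) (f : U -> U) (s : {perm U}) (X : {set U}) x :
  {in X, f =1 s} -> {in X, forall z, f z \in X} -> x \in X ->
  [set y | fconnect f x y] = porbit s x.
Proof.
move=> fs fX xX; have it n : iter n f x = (s ^+ n)%g x /\ iter n f x \in X.
  elim: n => [|n [IH1 IH2]]; first by rewrite expg0 perm1.
  by rewrite iterS fX // expgSr permM -IH1 fs.
apply/setP => y; rewrite inE; apply/idP/porbitP => [/iter_findex <-|[n ->]].
  by exists (findex f x y); case: (it (findex f x y)).
by case: (it n) => <- _; apply: fconnect_iter.
Qed.

Lemma euler_bound_darts :
  2 * (#|T| + n_faces e rho + n_isolated e) = 4 * n_components e + #|D| ->
  euler_bound D.
Proof.
move=> euler.
have revD : rev_closed D by move=> d; rewrite rev_dart_in.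
exists (perm (face_step_inj (subxx _) revD)) => [d|]; first by rewrite permE.
set s := perm _.
have -> : n_components (dart_rel D) = n_components e.
  suff clE : (fun x => [set y | connect (dart_rel D) x y])
             =1 fun x => [set y | connect e x y].
    by rewrite /n_components (eq_imset _ clE).
  move=> x; apply/setP => y; rewrite !inE; apply: eq_connect => {}x {}y.
  by rewrite /dart_rel inE.
suff : n_faces e rho + #|~: D| <= #|porbits s|.
  move: euler; set nT := #|T|; set nD := #|D|; set nF := #|porbits s|; lia.
have faceE d : d \in D -> [set d' | fconnect (face_perm rho) d d'] = porbit s d.
  apply: fconnect_porbit => c cD; last by rewrite rho_dart ?rev_dart_in.
  by rewrite permE /face_step cD rev_dart_in cD.
have fixE d : d \notin D -> porbit s d = [set d].
  move=> dD; apply/setP => c; rewrite inE; apply/porbitP/eqP => [[n ->]|->].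
    elim: n => [|n IHn]; first by rewrite expg0 perm1.
    by rewrite expgSr permM IHn permE /face_step !(negPf dD).
  by exists 0; rewrite expg0 perm1.
have -> : n_faces e rho = #|porbit s @: D|.
  by rewrite /n_faces (eq_in_imset faceE).
have -> : #|~: D| = #|porbit s @: ~: D|.
  rewrite card_in_imset // => c d; rewrite !in_setC => cD dD.
  by rewrite !fixE // => /set1_inj.
rewrite -cardsUI [X in _ + #|pred_of_set X|](_ : _ = set0) ?cards0 ?addn0.
  apply: subset_leq_card; rewrite -imsetU.
  by apply/subsetP => X /imsetP[d _ ->]; apply: imset_f.
apply/eqP; rewrite -subset0; apply/subsetP => X.
case/setIP=> /imsetP[c cD ->] /imsetP[d]; rewrite in_setC => dD E.
have := porbit_id s c; rewrite E fixE // inE => /eqP cd.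
by rewrite -cd cD in dD.
Qed.

(** If both darts of the edge lie on one orbit, the faces increase by one and the components by at
    most one; should the components stay the same, this only adds slack, which is why an inequality
    is carried. Otherwise the faces decrease by one, and the rest of the face through [d] still
    joins the ends of the edge. *)
Lemma euler_bound_delete A d : A \subset D -> rev_closed A -> d \in A ->
  euler_bound A -> euler_bound (A :\ d :\ rev_dart d).
Proof.
move=> sAD revA dA [s sE bound]; set d' := rev_dart d; set B := _ :\ d'.
have d'A : d' \in A by apply: revA.
have dd' : d != d'.
  apply/eqP; case: d dA @d' @B d'A => x y dA; rewrite /rev_dart /= => _ [xy _].
  by move/(subsetP sAD): dA; rewrite inE /is_dart xy /= irr.
have BE c : (c \in B) = [&& c != d', c != d & c \in A] by rewrite !inE.
have cardB : #|A| = #|B| + 2.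
  rewrite (cardsD1 d A) dA (cardsD1 d' (A :\ d)) -/B !inE eq_sym dd' d'A /=.
  by rewrite addnA addnC.
have symA : symmetric (dart_rel A).
  by move=> x y; rewrite /dart_rel; apply/idP/idP => /revA.
have revB : rev_closed B.
  move=> c; rewrite !BE => /and3P[cd' cd cA]; rewrite revA // andbT.
  by rewrite !(can2_eq rev_dartK rev_dartK) /d' rev_dartK cd cd'.
have symB : symmetric (dart_rel B).
  by move=> x y; rewrite /dart_rel; apply/idP/idP => /revB.
have sBA : subrel (dart_rel B) (dart_rel A).
  by move=> x y; rewrite /dart_rel BE => /and3P[].
have subA x y : dart_rel A x y ->
    dart_rel B x y \/ (x, y) = (d.1, d.2) \/ (x, y) = (d.2, d.1).
  rewrite /dart_rel BE => ->; rewrite andbT.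
  case: eqP => [->|_]; first by right; right.
  case: eqP => [->|_]; last by left.
  by right; left; case: (d).
(* Fixing [d] and [d'] in the edge involution instead of exchanging them is composition with their
   transposition. *)
pose t := (tperm d d' * s)%g.
have tE : t =1 face_step B.
  move=> c; rewrite permM sE /face_step BE.
  case: tpermP => [->|->|/eqP/negPf -> /eqP/negPf -> //].
    by rewrite d'A /d' rev_dartK eqxx andbF.
  by rewrite dA eqxx.
exists t => //.
move: bound; rewrite cardB; have /= := porbits_mul_tperm s d d'; rewrite dd' -/t.
set nT := #|T|; set nB := #|B|; set nt := #|porbits t|; set ns := #|porbits s|.
have uv : dart_rel A d.1 d.2 by rewrite /dart_rel; case: (d) dA.
case: (boolP (d \in porbit s d')) => [_|dd's] /= porb.
  by have := n_components_delete_bridge symB symA sBA subA uv; lia.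
suff conn : connect (dart_rel B) d.1 d.2.
  have := n_components_delete_nonbridge symB sBA subA conn; lia.
have stepB c : c != d -> c != d' -> connect (dart_rel B) c.1 (s c).1.
  move=> cd cd'; rewrite sE; case: (boolP (c \in D)) => cD.
    rewrite face_step_fst //; case: ifP => // cA; apply: connect1.
    by rewrite /dart_rel BE cd cd' -surjective_pairing cA.
  by rewrite /face_step (contraNF (subsetP sAD c)) ?(negPf cD).
have notd' n : iter n s d != d'.
  apply: contra dd's => /eqP <-; rewrite porbit_sym; apply/porbitP.
  by exists n; rewrite permX.
pose m := fingraph.order s d.
have m0 : 0 < m by apply: fingraph.order_gt0.
(* After its first step the orbit of [d] avoids [d] and [d'] until it returns to [d] at step [m];
   kept darts of [B] are edges of the walk, and cut darts do not move the source. *)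
have iterB n : 0 < n <= m -> connect (dart_rel B) d.2 (iter n s d).1.
  elim: n => // -[|n] IHn nm.
    by rewrite [iter 1 _ _]sE face_step_fst ?dA ?(subsetP sAD).
  apply: connect_trans (IHn _) _; first by lia.
  rewrite [X in _ X.1]iterS; apply: stepB => //.
  apply/eqP => it; have : findex s d (iter n.+1 s d) = n.+1.
    by rewrite findex_iter //; lia.
  by rewrite it findex0.
have := iterB m; rewrite m0 leqnn (iter_order perm_inj) => /(_ isT).
by rewrite (sym_connect_sym symB).
Qed.

Lemma euler_bound_sub A B : A \subset D -> rev_closed A ->
  B \subset A -> rev_closed B -> euler_bound A -> euler_bound B.
Proof.
move: {2}(#|A|) (leqnn #|A|) => n; elim: n A => [|n IHn] A.
  rewrite leqn0 cards_eq0 => /eqP -> _ _; rewrite subset0 => /eqP -> //.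
move=> An sAD revA sBA revB boundA.
have [AB|/subsetPn[d dA dB]] := boolP (A \subset B).
  by have <- : A = B by apply/eqP; rewrite eqEsubset AB.
apply: (IHn (A :\ d :\ rev_dart d)); last exact: euler_bound_delete.
- apply: leq_trans (subset_leq_card (subD1set _ _)) _.
  by rewrite (cardsD1 d A) dA in An.
- by rewrite (subset_trans _ sAD) // (subset_trans (subD1set _ _)) ?subD1set.
- move=> c; rewrite !inE => /and3P[c1 c2 cA]; rewrite revA // andbT.
  by rewrite !(can2_eq rev_dartK rev_dartK) rev_dartK c1 c2.
- apply/subsetP => c cB; rewrite !inE (subsetP sBA) // andbT.
  apply/andP; split; apply/eqP => cd; move: dB; last by rewrite -cd cB.
  by rewrite -[d]rev_dartK -cd revB.
- by [].
Qed.

End PlanarDeletion.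

Lemma porbit_succ (T : finType) (s : {perm T}) x : porbit s (s x) = porbit s x.
Proof. by rewrite -{2}[s]expg1 porbit_perm. Qed.

(** * Counting faces of G[S] when no reduction applies *)

Section Irreducible.
Variables (T : finType) (e : rel T) (rho : T * T -> T * T).
Hypothesis rot : rotation_system e rho.
Variable S : {set T}.
Local Notation D := (darts e).
Let A := [set d in D | (d.1 \in S) && (d.2 \in S)].
Let A3 := [set d in A | 3 <= deg_in e S d.1].

Let sAD : A \subset D. Proof. by apply/subsetP => d /setIdP[]. Qed.

(** A vertex outside [S] has lost all its darts and is a class by itself; [x0] gives one more
    class. *)
Lemma cut_components x0 : x0 \in S -> #|~: S| < n_components (dart_rel A).
Proof.
move=> x0S.
pose cl x := [set y | connect (dart_rel A) x y].
have clS x y : x \notin S -> connect (dart_rel A) x y -> x = y.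
  move=> xS /connectP[[|z q] //=].
  by rewrite /dart_rel in_set (negPf xS) andbF.
have -> : #|~: S|.+1 = #|x0 |: ~: S| by rewrite cardsU1 in_setC x0S.
rewrite -(@card_in_imset _ _ cl).
  apply: subset_leq_card; apply/subsetP => X /imsetP[x _ ->].
  exact: (imset_f cl).
move=> x y xin yin E.
have cxy : connect (dart_rel A) x y by move/setP/(_ y): E; rewrite !inE connect0.
have cyx : connect (dart_rel A) y x by move/setP/(_ x): E; rewrite !inE connect0.
move: xin yin; rewrite !inE => /orP[/eqP xE|xS _]; last exact: clS cxy.
by case/orP=> [/eqP->//|yS]; apply/esym; apply: clS cyx.
Qed.

Lemma deg_sum_lower (X : {set T}) c : X \subset S ->
  {in X, forall x, c <= deg_in e S x} -> c * #|X| <= #|[set d in A | d.1 \in X]|.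
Proof.
move=> sXS degX.
have -> : #|[set d in A | d.1 \in X]| = \sum_(x in X) deg_in e S x.
  rewrite -sum1dep_card.
  rewrite (eq_bigr (fun x => \sum_(y in [set y in S | e x y]) 1)); last first.
    by move=> x _; rewrite sum1_card.
  rewrite pair_big_dep; apply: eq_bigl => -[x y] /=.
  rewrite !in_set /is_dart /= andbC; case: (boolP (x \in X)) => //= /(subsetP sXS) ->.
  by rewrite andbC.
by rewrite mulnC -sum_nat_const; apply: leq_sum.
Qed.

Hypothesis deg2 : forall x, x \in S -> 2 <= deg_in e S x.

Variable s : {perm T * T}.
Hypothesis sE : s =1 face_step e rho A.

Lemma fconnect_rho c d : c \in D -> d \in D -> c.1 = d.1 -> fconnect rho c d.
Proof. by rewrite !inE; case: rot => _ _; apply. Qed.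

(** On cut half-edges the face step is [rho], so the face orbit turns around the vertex until it
    meets a kept dart. *)
Lemma first_kept_dart r n : r \in D -> iter n rho r \in A ->
  exists k, [/\ k <= n, iter k rho r \in A & iter k rho r \in porbit s r].
Proof.
elim: n r => [|n IHn] r rD hit; first by exists 0; rewrite porbit_id.
case: (boolP (r \in A)) => rA; first by exists 0; rewrite porbit_id.
rewrite iterSr in hit; have [k [kn kA ks]] := IHn _ (rho_dart rot rD) hit.
exists k.+1; rewrite iterSr; split=> //.
have <- : porbit s (rho r) = porbit s r.
  by rewrite -(face_step_cut rho rA rD) -sE porbit_succ.
by [].
Qed.

Lemma exists_other_neighbour x y : x \in S ->
  exists z, [/\ z \in S, e x z & z != y].
Proof.
move=> /deg2 xdeg; have : 0 < #|[set z in S | e x z] :\ y|.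
  by move: xdeg; rewrite /deg_in (cardsD1 y); case: (y \in _) => //; lia.
by case/card_gt0P => z; rewrite !inE => /and3P[zy zS xz]; exists z.
Qed.

(** An orbit off the darts is a fixed point; one through a vertex of [S] turns until it meets a kept
    dart; one at a vertex outside [S] is the whole rotation of that vertex. Isolated vertices lie
    outside [S] and have no such rotation orbit, which leaves room for [n_isolated e]. *)
Lemma cut_faces : #|porbits s| + n_isolated e <= #|~: D| + #|~: S| + #|porbit s @: A|.
Proof.
pose iso := [set x : T | [forall y, ~~ e x y]].
pose h x := [set d in D | d.1 == x].
have isoS : iso \subset ~: S.
  apply/subsetP => x; rewrite !inE => /forallP xiso; apply/negP => xS.
  by have [z [_ xz _]] := exists_other_neighbour x xS; move: (xiso z); rewrite xz.
have -> : #|~: S| = #|~: S :\: iso| + n_isolated e.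
  by rewrite addnC -(cardsID iso (~: S)) (setIidPr isoS).
suff sub : porbits s \subset
    (porbit s @: ~: D) :|: (h @: (~: S :\: iso)) :|: (porbit s @: A).
  have := subset_leq_card sub.
  have := leq_imset_card (porbit s) (~: D); have := leq_imset_card h (~: S :\: iso).
  have := cardsU ((porbit s @: ~: D) :|: (h @: (~: S :\: iso))) (porbit s @: A).
  have := cardsU (porbit s @: ~: D) (h @: (~: S :\: iso)).
  set a := #|porbits s|; set b := #|~: D|; lia.
apply/subsetP => _ /imsetP[d _ ->]; rewrite !in_setU.
have [dD|dD] := boolP (d \in D); last by rewrite imset_f ?in_setC.
have [dS|dS] := boolP (d.1 \in S).
  have [z [zS ez _]] := exists_other_neighbour d.1 dS.
  have zA : (d.1, z) \in A by rewrite 2!in_set /is_dart ez dS.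
  have conn : fconnect rho d (d.1, z).
    by apply: fconnect_rho => //; apply: (subsetP sAD).
  have [|k [_ kA ks]] := first_kept_dart (n := findex rho d (d.1, z)) dD.
    by rewrite iter_findex.
  rewrite -eq_porbit_mem in ks; rewrite -(eqP ks).
  by rewrite [X in _ || X](imset_f (porbit s) kA) orbT.
have -> : porbit s d = h d.1.
  rewrite -(@fconnect_porbit _ rho s (h d.1)).
  - apply/setP => c; rewrite [LHS]in_set [RHS]in_set.
    apply/idP/andP => [conn|[cD /eqP cd]].
      suff : c \in h d.1 by rewrite in_set => /andP.
      rewrite -(iter_findex conn); elim: (findex _ _ _) => [|n IHn].
        by rewrite in_set dD /=.
      move: IHn; rewrite in_set => /andP[h1 h2].
        by rewrite in_set iterS (rho_dart rot h1) (rho_fst rot h1).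
    by apply: fconnect_rho => //; rewrite cd.
  - move=> c; rewrite in_set => /andP[cD /eqP cd]; rewrite sE face_step_cut //.
    by rewrite in_set cd (negPf dS) andbF.
  - move=> c; rewrite in_set => /andP[cD cd].
    by rewrite in_set (rho_dart rot cD) (rho_fst rot cD).
  - by rewrite in_set dD /=.
rewrite [X in _ || X || _]imset_f ?orbT // !in_set dS andbT.
by apply/negP => /forallP/(_ d.2); move: dD; rewrite inE /is_dart => ->.
Qed.

Hypotheses (sym : symmetric e) (irr : irreflexive e).

(** A second neighbour of [d.2] in [S] puts a kept dart other than the reverse of [d] on the
    rotation at [d.2]. The first kept dart met comes no later, hence before the rotation returns to
    the reverse of [d]. *)
Lemma exists_next_dart d : d \in A ->
  exists d', [/\ d' \in A, d'.1 = d.2, d'.2 != d.1 & d' \in porbit s d].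
Proof.
move=> dA; have dD := subsetP sAD d dA; have := dA.
rewrite in_set => /and3P[_ d1 d2].
have [z [zS ez zd]] := exists_other_neighbour d.1 d2.
have rD : rev_dart d \in D by rewrite rev_dart_in.
have zA : (d.2, z) \in A by rewrite 2!in_set /is_dart ez d2.
have conn : fconnect rho (rev_dart d) (d.2, z).
  by apply: fconnect_rho => //; apply: (subsetP sAD).
have lt_ord := findex_max conn; have it := iter_findex conn.
case: (findex _ _ _) => [|n] in lt_ord it.
  by case: it => zE; rewrite zE eqxx in zd.
rewrite iterSr in it.
have hit : iter n rho (rho (rev_dart d)) \in A by rewrite it.
have [k [kn kA ks]] := first_kept_dart (rho_dart rot rD) hit.
have fstE i : (iter i.+1 rho (rev_dart d)).1 = d.2 /\ iter i.+1 rho (rev_dart d) \in D.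
  elim: i => [|i [IH1 IH2]].
    by rewrite [iter 1 _ _]/= (rho_fst rot) ?(rho_dart rot).
  by rewrite iterS (rho_fst rot) // (rho_dart rot).
exists (iter k.+1 rho (rev_dart d)); split; first by rewrite iterSr.
- by case: (fstE k).
- apply/eqP => E; have : iter k.+1 rho (rev_dart d) = rev_dart d.
    by rewrite [LHS]surjective_pairing E; case: (fstE k) => ->.
  move=> E'; have := findex_iter (f := rho) (x := rev_dart d) (i := k.+1).
  by rewrite E' findex0 => /(_ (leq_ltn_trans _ lt_ord)) => /(_ kn).
rewrite iterSr; move: ks; rewrite -(face_step_kept rho sym dA dD) -sE.
by rewrite porbit_succ.
Qed.

(** Any dart of the orbit that continues [d] without turning back is accepted: the count uses only
    that walks stay on one face and never backtrack. *)
Definition next_dart d :=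
  odflt d [pick d' in A | [&& d'.1 == d.2, d'.2 != d.1 & d' \in porbit s d]].

Lemma next_dartP d : d \in A ->
  [/\ next_dart d \in A, (next_dart d).1 = d.2, (next_dart d).2 != d.1
    & next_dart d \in porbit s d].
Proof.
rewrite /next_dart => /exists_next_dart[d' [h1 h2 h3 h4]]; case: pickP => /= [c|/(_ d')].
  by case/and4P=> ? /eqP.
by rewrite h1 h2 eqxx h3 h4.
Qed.

Variable p : nat.
Hypotheses (p2 : 2 <= p) (girth : girth_ge e (5 * p - 4)).
Hypothesis no_ear : forall x y mid, uniq (x :: rcons mid y) ->
  path e x (rcons mid y) -> all (fun v => v \in S) (x :: rcons mid y) ->
  all (fun v => deg_in e S v == 2) mid -> (size mid).+1 < p.


Section Walk.
Variables (d : T * T) (dA : d \in A).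

Let w i := (iter i next_dart d).1.

Lemma walk_kept i : iter i next_dart d \in A.
Proof. by elim: i => //= i /next_dartP[]. Qed.

Lemma walk_porbit i : iter i next_dart d \in porbit s d.
Proof.
elim: i => [|i IHi]; first exact: porbit_id.
rewrite -eq_porbit_mem in IHi.
by case: (next_dartP (walk_kept i)) => _ _ _; rewrite /= -(eqP IHi).
Qed.

Lemma walk_edge i : e (w i) (w i.+1).
Proof.
case: (next_dartP (walk_kept i)) => _ E _ _; rewrite /w iterS E.
by have := subsetP sAD _ (walk_kept i); rewrite inE.
Qed.

Lemma walk_in i : w i \in S.
Proof. by have := walk_kept i; rewrite in_set => /and3P[]. Qed.

Lemma walk_inj i j : i < j -> j - i < 5 * p - 4 -> w i != w j.
Proof.
apply: (nonbacktracking_inj irr girth walk_edge) => {}i.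
case: (next_dartP (walk_kept i)) => h E N _.
by case: (next_dartP h) => _ E' _ _; rewrite /w !iterS E' eq_sym.
Qed.

Lemma walk_uniq i n : n <= 5 * p - 4 -> uniq (map w (iota i n)).
Proof.
move=> nj; rewrite map_inj_in_uniq ?iota_uniq // => a b.
rewrite !mem_iota => ai bi; case: (ltngtP a b) => // ab /eqP; last rewrite eq_sym;
  by rewrite (negPf (walk_inj _ _)) //; lia.
Qed.

(** Otherwise the p-1 vertices after [w i] are the interior of a strict ear of length p, whose p+1
    vertices are distinct because p < 5p-4. *)
Lemma walk_branch i : exists2 j, i < j < i + p & 3 <= deg_in e S (w j).
Proof.
case: (boolP (has (fun j => 3 <= deg_in e S (w j)) (iota i.+1 p.-1))) => [/hasP|].
  by case=> j; rewrite mem_iota => ij jdeg; exists j => //; lia.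
rewrite -all_predC => /allP small.
pose mid := map w (iota i.+1 p.-1).
have earE : rcons mid (w (i + p)) = map w (iota i.+1 p).
  rewrite -cats1 /mid -[[:: w _]]/(map w [:: i + p]) -map_cat; congr map.
  have -> : [:: i + p] = iota (i.+1 + p.-1) 1 by congr [:: _]; lia.
  by rewrite -iotaD; congr iota; lia.
have := no_ear (x := w i) (y := w (i + p)) (mid := mid).
rewrite earE size_map size_iota -[w i :: _]/(map w (iota i p.+1)).
rewrite walk_uniq ?path_map_iota; [|exact: walk_edge|lia].
move=> /(_ isT isT) H; suff : p.-1.+1 < p by lia.
apply: H; apply/allP => _ /mapP[j jin ->]; first exact: walk_in.
by have := small j jin; have := deg2 (walk_in j); rewrite /= eqn_leq; lia.
Qed.

End Walk.

Lemma face_branches d : d \in A -> 6 <= #|porbit s d :&: A3|.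
Proof.
move=> dA; have [j0 _ deg0] := walk_branch dA 0.
have d0A := walk_kept dA j0; move: deg0.
have <- : porbit s (iter j0 next_dart d) = porbit s d.
  by apply/eqP; rewrite eq_porbit_mem walk_porbit.
set c := iter j0 next_dart d in d0A * => deg0.
(* The walk now starts at a branch corner, the first of the six. The five windows of p-1 positions
   that follow are consecutive and end at 5(p-1), just below the girth bound, so the six vertices
   are distinct. *)
have br := walk_branch d0A.
have [j1 b1 deg1] := br 0; have [j2 b2 deg2'] := br p.-1.
have [j3 b3 deg3] := br (2 * p.-1); have [j4 b4 deg4] := br (3 * p.-1).
have [j5 b5 deg5] := br (4 * p.-1).
pose l := [:: 0; j1; j2; j3; j4; j5].
have uniq_l : uniq (map (fun j => (iter j next_dart c).1) l).
  rewrite map_inj_in_uniq; first by rewrite /l /= !inE; lia.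
  have small j : j \in l -> j <= 5 * p.-1 by rewrite !inE; lia.
  move=> a b /small al /small bl; case: (ltngtP a b) => // ab /eqP; last rewrite eq_sym;
    by rewrite (negPf (walk_inj d0A _ _)) //; lia.
have uniq_c : uniq (map (fun j => iter j next_dart c) l).
  by apply: (@map_uniq _ _ fst); rewrite -map_comp.
rewrite -[6]/(size (map (fun j => iter j next_dart c) l)) -(card_uniqP uniq_c).
apply/subset_leq_card/subsetP => b /mapP[j jl ->].
rewrite inE walk_porbit // in_set walk_kept //=.
by move: jl; rewrite !inE => /or4P[/eqP->|/eqP->|/eqP->|/or3P[] /eqP->].
Qed.

(** Distinct orbits are disjoint and each takes at least six darts of [A3]. *)
Lemma face_count : 6 * #|porbit s @: A| <= #|A3|.
Proof.
pose P := [set X :&: A3 | X in porbit s @: A].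
have porb3 X : X \in porbit s @: A -> exists2 d, d \in A & X = porbit s d.
  by case/imsetP => d dA ->; exists d.
have ne X : X \in porbit s @: A -> exists2 d, d \in X & d \in X :&: A3.
  case/porb3 => d dA ->; have /card_gt0P[c cX] : 0 < #|porbit s d :&: A3|.
    exact: leq_trans (face_branches dA).
  by exists c => //; case/setIP: cX.
have same X Y c : X \in porbit s @: A -> Y \in porbit s @: A ->
    c \in X -> c \in Y -> X = Y.
  case/porb3=> d _ ->; case/porb3=> d' _ ->.
  by rewrite -!eq_porbit_mem => /eqP <- /eqP.
have cardP : #|porbit s @: A| = #|P|.
  rewrite [RHS]card_in_imset // => X Y XA YA E.
  have [c cX cX3] := ne X XA; apply: (same X Y c) => //.
  by move: cX3; rewrite E => /setIP[].
have trivP : trivIset P.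
  apply/trivIsetP => _ _ /imsetP[X XA ->] /imsetP[Y YA ->] XY.
  rewrite -setI_eq0; apply: contraNT XY => /set0Pn[c].
  rewrite !inE => /andP[/andP[cX _] /andP[cY _]].
  by rewrite (same X Y c).
have coverP : cover P \subset A3.
  by apply/bigcupsP => _ /imsetP[X _ ->]; apply: subsetIr.
apply: leq_trans (subset_leq_card coverP).
rewrite -(eqP trivP) cardP mulnC -sum_nat_const; apply: leq_sum.
by move=> _ /imsetP[_ /imsetP[d dA ->] ->]; apply: face_branches.
Qed.

End Irreducible.

Lemma not_irreducible (T : finType) (e : rel T) (p : nat) (S : {set T}) x0 :
  simple_graph e -> planar e -> 2 <= p -> girth_ge e (5 * p - 4) ->
  x0 \in S -> (forall x, x \in S -> 2 <= deg_in e S x) ->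
  (forall x y mid, uniq (x :: rcons mid y) ->
    path e x (rcons mid y) -> all (fun v => v \in S) (x :: rcons mid y) ->
    all (fun v => deg_in e S v == 2) mid -> (size mid).+1 < p) -> False.
Proof.
move=> [sym irr] [rho [rot euler]] p2 girth x0S deg2 no_ear.
pose A := [set d in darts e | (d.1 \in S) && (d.2 \in S)].
have sAD : A \subset darts e by apply/subsetP => d /setIdP[].
have revA : rev_closed A.
  by move=> d; rewrite in_set => /and3P[dD d1 d2]; rewrite in_set rev_dart_in // dD d2 d1.
have revD : rev_closed (darts e) by move=> d; rewrite rev_dart_in.
have [s sE bound] := euler_bound_sub sym irr rot (subxx _) revD sAD revA
                       (euler_bound_darts sym rot euler).
pose S3 := [set x in S | 3 <= deg_in e S x].
have sS3 : S3 \subset S by apply/subsetP => x /setIdP[].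
have c1 : #|~: S| < n_components (dart_rel A) := cut_components e x0S.
have c2 : #|porbits s| + n_isolated e
    <= #|~: darts e| + #|~: S| + #|porbit s @: A| := cut_faces rot deg2 sE.
have c3 := face_count rot deg2 sE sym irr p2 girth no_ear.
have c4 : 3 * #|S3| <= #|[set d in A | d.1 \in S3]|.
  by apply: deg_sum_lower => // x; rewrite in_set => /andP[].
have c5 : 2 * #|S :\: S3| <= #|[set d in A | d.1 \in S :\: S3]|.
  by apply: deg_sum_lower; rewrite ?subsetDl // => x /setDP[/deg2].
have S3E : [set d in A | 3 <= deg_in e S d.1] = [set d in A | d.1 \in S3].
  by apply/setP => d; rewrite !in_set; case: (d.1 \in S); rewrite ?andbF.
have cardA : #|A| = #|[set d in A | d.1 \in S3]|
                    + #|[set d in A | d.1 \in S :\: S3]|.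
  rewrite -(cardsID [set d | d.1 \in S3] A); congr (_ + _); apply: eq_card => d.
    by rewrite !in_set.
  by rewrite !in_set; case: (d.1 \in S); rewrite ?andbF ?andbT //= andbC.
have cardS := cardsID S3 S; rewrite (setIidPr sS3) in cardS.
have cardT := cardsC S.
rewrite -/A S3E in c3.
(* The terms for vertices outside [S] and for pairs off the darts cancel, leaving 4 + |A| <= 2|S| +
   2F, which the bounds on |A| and F contradict. *)
move: bound c2 c3 cardA cardT cardS c4 c5 c1.
set nT := #|T|; set nP := #|porbits s|; set nA := #|A|; set nI := n_isolated e.
set nD := #|~: darts e|; set nF := #|porbit s @: A|; set nOut := #|~: S|.
set nS := #|S|; set nS3 := #|S3|.
set nS2 := #|S :\: S3|; set nA3 := #|_|; set nA2 := #|_|.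
clear; clearbody nT nP nA nI nD nF nS nOut nA2 nA3 nS3 nS2; lia.
Qed.

Lemma planar_path_degenerate (T : finType) (e : rel T) (p : nat) :
  2 <= p -> simple_graph e -> planar e -> girth_ge e (5 * p - 4) ->
  path_degenerate e p.
Proof.
move=> p2 simple pl girth; rewrite /path_degenerate.
move: [set: T] => S; have [n] := ubnP #|S|; elim: n S => // n IHn S.
rewrite ltnS => Sn; have [->|/set0Pn[x0 x0S]] := eqVneq S set0; first exact: p_red_empty.
(* If G[S] is not reducible then no reduction applies to it, since the result would be reducible by
   induction. *)
apply: NNPP => irred.
apply: (not_irreducible simple pl p2 girth x0S) => [x xS|x y mid us pth inS deg].
  rewrite ltnNge; apply/negP => deg1; apply: irred.
  apply: (@p_red_step _ _ _ _ (S :\ x)); first by left; exists x.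
  by apply: IHn; rewrite (cardsD1 x) xS in Sn.
rewrite ltnNge; apply/negP => midp; apply: irred.
apply: (@p_red_step _ _ _ _ (S :\: [set v in mid])); first by right; exists x, y, mid.
apply: IHn; apply: leq_trans Sn; apply: proper_card; apply/properP; split.
  exact: subsetDl.
(* As p >= 2, the ear has an internal vertex, so its deletion shrinks [S]. *)
case: mid midp us inS {pth deg} => [|v mid] /=; first by move=> midp; lia.
move=> _ _ /and3P[_ vS _]; exists v => //.
by rewrite !inE eqxx.
Qed.

(** * Graphs of combinatorial maps *)

Lemma leq_card_imset (A B C : finType) (f : A -> B) (g : A -> C) (X : {set A}) :
  (forall a b, g a = g b -> f a = f b) -> #|f @: X| <= #|g @: X|.
Proof.
move=> gf; have [->|[a0 a0X]] := set_0Vmem X; first by rewrite !imset0 !cards0.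
pose h c := f (odflt a0 [pick a | g a == c]).
apply: leq_trans (leq_imset_card h _).
apply/subset_leq_card/subsetP => _ /imsetP[a aX ->].
apply/imsetP; exists (g a); first exact: imset_f.
by rewrite /h; case: pickP => [b /eqP/gf -> //|/(_ a)]; rewrite eqxx.
Qed.

Section MapGraph.
Variables (St T : finType) (src : St -> T) (rot opp : St -> St).
Hypothesis oppK : involutive opp.
Hypothesis rot_inj : injective rot.
Hypothesis src_rot : forall s, src (rot s) = src s.
Hypothesis src_conn : forall s s', src s = src s' -> fconnect rot s s'.
Hypothesis src_opp : forall s, src (opp s) != src s.
Hypothesis src_surj : forall x, exists s, src s = x.

(** States play the role of darts. Injectivity of this map excludes parallel edges, as [src_opp]
    excludes loops. *)
Definition dart_of s := (src s, src (opp s)).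
Hypothesis dart_of_inj : injective dart_of.

Definition map_edge : rel T := fun x y => [exists s, dart_of s == (x, y)].

Lemma map_edgeP x y : reflect (exists s, dart_of s = (x, y)) (map_edge x y).
Proof. by apply: (iffP existsP) => -[s /eqP sE]; exists s. Qed.

Lemma map_edge_dart s : map_edge (src s) (src (opp s)).
Proof. by apply/map_edgeP; exists s. Qed.

Lemma map_graph_simple : simple_graph map_edge.
Proof.
split=> [x y|x].
  apply/map_edgeP/map_edgeP => -[s [sx sy]]; exists (opp s);
    by rewrite /dart_of oppK sx sy.
by apply/map_edgeP => -[s [sx sy]]; have := src_opp s; rewrite sx sy eqxx.
Qed.

Lemma map_dartP d : reflect (exists s, d = dart_of s) (is_dart map_edge d).
Proof.
apply: (iffP (map_edgeP _ _)) => -[s sE]; exists s; last by rewrite sE; case: (dart_of s).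
by rewrite sE; case: (d).
Qed.

Lemma map_darts : darts map_edge = dart_of @: [set: St].
Proof.
apply/setP => d; rewrite inE; apply/map_dartP/imsetP => -[s]; first by exists s.
by exists s.
Qed.

Definition map_rotation d :=
  if [pick s | dart_of s == d] is Some s then dart_of (rot s) else d.

Lemma map_rotation_dart s : map_rotation (dart_of s) = dart_of (rot s).
Proof.
rewrite /map_rotation; case: pickP => [s' /eqP/dart_of_inj -> //|/(_ s)].
by rewrite eqxx.
Qed.

Lemma fconnect_conj (A B : finType) (f : A -> A) (g : B -> B) (h : A -> B) a b :
  injective h -> (forall a, g (h a) = h (f a)) ->
  fconnect g (h a) (h b) = fconnect f a b.
Proof.
move=> h_inj gh; have it n : iter n g (h a) = h (iter n f a).
  by elim: n => //= n ->.
apply/idP/idP => /iter_findex; last by move=> <-; rewrite -it fconnect_iter.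
by rewrite it => /h_inj <-; rewrite fconnect_iter.
Qed.

Lemma map_rotation_system : rotation_system map_edge map_rotation.
Proof.
split=> [d|d d'|d d'].
- case/map_dartP=> s ->; rewrite map_rotation_dart.
  by split; [apply: map_edge_dart | apply: src_rot].
- rewrite !inE => /map_dartP[s ->] /map_dartP[s' ->].
  by rewrite !map_rotation_dart => /dart_of_inj/rot_inj ->.
case/map_dartP=> s -> /map_dartP[s' ->] /= /src_conn.
by rewrite (fconnect_conj _ _ dart_of_inj map_rotation_dart).
Qed.

Definition map_face s := rot (opp s).

Lemma map_face_perm s :
  face_perm map_rotation (dart_of s) = dart_of (map_face s).
Proof. by rewrite -map_rotation_dart /face_perm /= /dart_of oppK. Qed.

Lemma map_n_faces (F : finType) (label : St -> F) :
  (forall s s', fconnect map_face s s' <-> label s = label s') ->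
  n_faces map_edge map_rotation = #|label @: [set: St]|.
Proof.
move=> labelP; rewrite /n_faces map_darts -imset_comp.
apply/eqP; rewrite eqn_leq !leq_card_imset // => s s' /=.
  move/setP/(_ (dart_of s')); rewrite !inE connect0.
  by rewrite (fconnect_conj _ _ dart_of_inj map_face_perm) => /labelP.
move=> ss'; apply/setP => d; rewrite !inE.
have conn t t' : label t = label t' ->
    fconnect (face_perm map_rotation) (dart_of t) (dart_of t').
  by move/labelP; rewrite (fconnect_conj _ _ dart_of_inj map_face_perm).
by apply/idP/idP; apply: connect_trans; apply: conn.
Qed.

Lemma map_n_isolated : n_isolated map_edge = 0.
Proof.
apply: eq_card0 => x; rewrite inE; apply/negP => /forallP.
by have [s <-] := src_surj x => /(_ (src (opp s))); rewrite map_edge_dart.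
Qed.

Lemma map_planar (F : finType) (label : St -> F) :
  (forall s s', fconnect map_face s s' <-> label s = label s') ->
  n_components map_edge = 1 -> 
  2 * (#|T| + #|label @: [set: St]|) = 4 + #|St| -> planar map_edge.
Proof.
move=> labelP comp euler; exists map_rotation; split; first exact: map_rotation_system.
rewrite map_n_isolated addn0 (map_n_faces labelP) euler comp.
by rewrite map_darts card_imset // cardsT.
Qed.

Lemma map_deg X s : uniq X -> (forall t, t \in X -> src t = src s) ->
  size X <= deg_in map_edge [set: T] (src s).
Proof.
move=> uX srcX; have uY : uniq (map (src \o opp) X).
  rewrite map_inj_in_uniq // => t t' /srcX ts /srcX ts' /= E.
  by apply: dart_of_inj; rewrite /dart_of ts ts' E.
rewrite -(size_map (src \o opp)) -(card_uniqP uY).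
apply/subset_leq_card/subsetP => _ /mapP[t tX ->]; rewrite !inE /=.
by rewrite -(srcX t tX) map_edge_dart.
Qed.

Definition follows s s' := (src s' == src (opp s)) && (s' != opp s).

(** Lifts a vertex walk to states, where it can be studied through [rot] and [opp]. *)
Lemma map_walk (w : nat -> T) n :
  (forall i, i <= n -> map_edge (w i) (w i.+1)) ->
  (forall i, i < n -> w i != w i.+2) ->
  exists st : nat -> St, (forall i, i <= n -> dart_of (st i) = (w i, w i.+1))
    /\ forall i, i < n -> follows (st i) (st i.+1).
Proof.
move=> wE wN; have [s0 _] := src_surj (w 0).
pose st i := odflt s0 [pick s | dart_of s == (w i, w i.+1)].
have stE i : i <= n -> dart_of (st i) = (w i, w i.+1).
  move/wE/map_edgeP => [s sE]; rewrite /st; case: pickP => [t /eqP //|/(_ s)].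
  by rewrite sE eqxx.
exists st; split=> // i ni; have [h1 h2] := stE i (ltnW ni); have [h3 h4] := stE _ ni.
rewrite /follows h2 h3 eqxx /=; apply: contraNN (wN i ni) => /eqP E.
by rewrite -h4 E oppK h1.
Qed.

End MapGraph.

(** * The dodecahedron *)

(* The darts are 0, ..., 59, and 2a, 2a+1 are the two orientations of edge a.
   The tables give the initial vertex of each dart, the next dart around that
   vertex, and the face on its side. *)
Definition dodeca_origin : seq nat := [::
  0; 1; 1; 2; 2; 3; 3; 4; 4; 0; 0; 5; 1; 6; 2; 7; 3; 8; 4; 9;
  5; 10; 10; 6; 6; 11; 11; 7; 7; 12; 12; 8; 8; 13; 13; 9; 9; 14; 14; 5;
  10; 15; 11; 16; 12; 17; 13; 18; 14; 19; 15; 16; 16; 17; 17; 18; 18; 19; 19; 15].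

Definition dodeca_rot : seq nat := [::
  10; 2; 12; 4; 14; 6; 16; 8; 18; 0; 9; 20; 1; 24; 3; 28; 5; 32; 7; 36;
  39; 22; 40; 13; 23; 26; 42; 15; 27; 30; 44; 17; 31; 34; 46; 19; 35; 38; 48; 11;
  21; 50; 25; 52; 29; 54; 33; 56; 37; 58; 59; 43; 51; 45; 53; 47; 55; 49; 57; 41].

Definition dodeca_face : seq nat := [::
  0; 1; 0; 2; 0; 3; 0; 4; 0; 5; 1; 5; 2; 1; 3; 2; 4; 3; 5; 4;
  1; 6; 1; 7; 2; 7; 2; 8; 3; 8; 3; 9; 4; 9; 4; 10; 5; 10; 5; 6;
  7; 6; 8; 7; 9; 8; 10; 9; 6; 10; 7; 11; 8; 11; 9; 11; 10; 11; 6; 11].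

Definition org d := nth 0 dodeca_origin d.
Definition rotn d := nth 0 dodeca_rot d.
Definition facen d := nth 0 dodeca_face d.
Definition revn d := if odd d then d.-1 else d.+1.
Definition phin d := rotn (revn d).

(** In a cubic graph a nonbacktracking walk has two continuations at each vertex; these are the
    possible last darts after [n] further steps. *)
Fixpoint walk_ends n d : seq nat :=
  if n is n'.+1 then
    walk_ends n' (phin d) ++ walk_ends n' (rotn (phin d))
  else [:: d].

Definition darts60 := iota 0 60.

Lemma dart60P (P : pred nat) : all P darts60 -> forall d, d < 60 -> P d.
Proof. by move=> /allP h d d60; apply: h; rewrite mem_iota. Qed.

Lemma dart60P2 (P : rel nat) : all (fun d => all (P d) darts60) darts60 ->
  forall d d', d < 60 -> d' < 60 -> P d d'.
Proof. by move=> h d d' d60; apply: dart60P; apply: (dart60P h). Qed.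

Lemma org_lt d : d < 60 -> org d < 20.
Proof. by move: d; apply: dart60P; vm_compute. Qed.

Lemma rotn_lt d : d < 60 -> rotn d < 60.
Proof. by move: d; apply: dart60P; vm_compute. Qed.

Lemma facen_lt d : d < 60 -> facen d < 12.
Proof. by move: d; apply: dart60P; vm_compute. Qed.

Lemma revn_lt d : d < 60 -> revn d < 60.
Proof. by move: d; apply: dart60P; vm_compute. Qed.

Lemma revnK d : revn (revn d) = d.
Proof.
rewrite /revn; case: (boolP (odd d)) => d_odd; last by rewrite /= d_odd.
by case: d d_odd => //= d /negPf ->.
Qed.

Lemma phin_lt d : d < 60 -> phin d < 60.
Proof. by move=> /revn_lt/rotn_lt. Qed.

Lemma org_rotn d : d < 60 -> org (rotn d) = org d.
Proof. by move=> d60; apply/eqP; move: d d60; apply: dart60P; vm_compute. Qed.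

Lemma rotn3 d : d < 60 -> rotn (rotn (rotn d)) = d.
Proof. by move=> d60; apply/eqP; move: d d60; apply: dart60P; vm_compute. Qed.

Lemma rotn_neq d : d < 60 -> (rotn d != d) && (rotn (rotn d) != d).
Proof. by move: d; apply: dart60P; vm_compute. Qed.

Lemma org_revn d : d < 60 -> org (revn d) != org d.
Proof. by move: d; apply: dart60P; vm_compute. Qed.

Lemma org_eqP d d' : d < 60 -> d' < 60 -> org d == org d' ->
  d' \in [:: d; rotn d; rotn (rotn d)].
Proof.
move=> h h'; apply/implyP; move: d d' h h'.
by apply: dart60P2; vm_compute.
Qed.

Lemma org_inj d d' : d < 60 -> d' < 60 ->
  org d = org d' -> org (revn d) = org (revn d') -> d = d'.
Proof.
move=> h h' /eqP e1 /eqP e2; apply/eqP; move: e2; apply/implyP; move: e1; apply/implyP.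
by move: d d' h h'; apply: dart60P2; vm_compute.
Qed.

Lemma facen_phin d : d < 60 -> facen (phin d) = facen d.
Proof. by move=> d60; apply/eqP; move: d d60; apply: dart60P; vm_compute. Qed.

(** The faces are pentagons: five iterates of [phin] meet every dart with the same label. *)
Lemma facen_eqP d d' : d < 60 -> d' < 60 -> facen d = facen d' ->
  d' \in [seq iter i phin d | i <- iota 0 5].
Proof.
move=> h h' /eqP; apply/implyP; move: d d' h h'.
by apply: dart60P2; vm_compute.
Qed.

Lemma org_surj v : v < 20 -> exists2 d, d < 60 & org d = v.
Proof.
move=> v20; have /mapP[d] : v \in map org darts60.
  by move: v v20; have /allP h : all (mem (map org darts60)) (iota 0 20)
    by []; move=> v v20; apply: h; rewrite mem_iota.
by rewrite mem_iota; exists d.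
Qed.

Lemma facen_surj f : f < 12 -> exists2 d, d < 60 & facen d = f.
Proof.
move=> f12; have /mapP[d] : f \in map facen darts60.
  by move: f f12; have /allP h : all (mem (map facen darts60)) (iota 0 12)
    by []; move=> f f12; apply: h; rewrite mem_iota.
by rewrite mem_iota; exists d.
Qed.

(** Serves connectedness: repeated descent leads from any vertex to 0. *)
Lemma lower_neighbour v : v < 19 ->
  exists d, [/\ d < 60, org d = v.+1 & org (revn d) < v.+1].
Proof.
move=> v19.
have /hasP[d] : has (fun d => (org d == v.+1) && (org (revn d) < v.+1)) darts60.
  have : v \in iota 0 19 by rewrite mem_iota.
  move: v {v19}; apply/allP; by vm_compute.
by rewrite mem_iota => d60 /andP[/eqP]; exists d.
Qed.

(** The lower bound 5 on the girth of the dodecahedron, stated for closed nonbacktracking walks of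
    darts and checked by enumeration. *)
Lemma no_short_walk n d : d < 60 -> 0 < n < 5 -> d \notin walk_ends n d.
Proof.
move=> d60 n5; have : n \in [:: 1; 2; 3; 4] by rewrite !inE; lia.
move: d d60.
have h : all (fun d => all (fun n => d \notin walk_ends n d) [:: 1; 2; 3; 4]) darts60.
  by vm_compute.
by move=> d /(dart60P h)/allP; apply.
Qed.

(** * The subdivided dodecahedron as a combinatorial map *)

Section SubdividedDodecahedron.
Variable r : nat.

Local Notation state := ('I_60 * 'I_r.+1)%type.
Local Notation vertex := ('I_20 + 'I_30 * 'I_r)%type.

Implicit Types s t : state.

Definition rev0 (d : 'I_60) : 'I_60 := Ordinal (revn_lt (ltn_ord d)).
Definition rot0 (d : 'I_60) : 'I_60 := Ordinal (rotn_lt (ltn_ord d)).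
Definition org0 (d : 'I_60) : 'I_20 := Ordinal (org_lt (ltn_ord d)).
Definition face0 (d : 'I_60) : 'I_12 := Ordinal (facen_lt (ltn_ord d)).

Lemma edge0_proof (d : 'I_60) : d./2 < 30.
Proof. by have := ltn_ord d; lia. Qed.
Definition edge0 (d : 'I_60) : 'I_30 := Ordinal (edge0_proof d).

(* The state (d, i) is the i-th dart on the path of length r+1 replacing the
   dodecahedron dart d. The inner vertices of that path are numbered along the
   even orientation of the edge. *)
Definition src (s : state) : vertex :=
  if unlift ord0 s.2 is Some j
  then inr (edge0 s.1, if odd s.1 then rev_ord j else j)
  else inl (org0 s.1).

(** Position i along a dart is position r+1-i along its reverse, which gives the other dart at an
    inner vertex. The reverse of the i-th dart starts at position i+1 instead, so its index in [opp]
    is r-i. *)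
Definition rot (s : state) : state :=
  if s.2 == ord0 then (rot0 s.1, ord0) else (rev0 s.1, inord (r.+1 - s.2)).

Definition opp (s : state) : state := (rev0 s.1, rev_ord s.2).

Lemma state_eq (s t : state) : s.1 = t.1 :> nat -> s.2 = t.2 :> nat -> s = t.
Proof. by case: s t => [d i] [d' i'] /= h h'; congr pair; apply: val_inj. Qed.

Lemma oppK : involutive opp.
Proof. by move=> s; apply: state_eq; rewrite /= ?revnK //; have := ltn_ord s.2; lia. Qed.

Lemma rot_branch s : s.2 = 0 :> nat -> rot s = (rot0 s.1, ord0).
Proof. by move=> s0; rewrite /rot -val_eqE /= s0. Qed.

Lemma rot_inner s : 0 < s.2 -> (rot s).1 = rev0 s.1 /\ (rot s).2 = r.+1 - s.2 :> nat.
Proof.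
by move=> s0; rewrite /rot -val_eqE /= eqn0Ngt s0 inordK //=; have := ltn_ord s.2; lia.
Qed.

Variant src_spec (s t : state) : Prop :=
  | SrcBranch of s.2 = 0 :> nat & t.2 = 0 :> nat & org s.1 = org t.1
  | SrcSame of 0 < s.2 & t = s
  | SrcRot of 0 < s.2 & t = rot s.

Lemma half_eq_revn m n : m./2 = n./2 -> odd m != odd n -> n = revn m.
Proof. by rewrite /revn; case: ifP; lia. Qed.

Lemma odd_revn n : odd (revn n) = ~~ odd n.
Proof. by rewrite /revn; case: ifP => [|/= -> //]; case: n => //= n; case: (odd n). Qed.

Lemma half_revn n : (revn n)./2 = n./2.
Proof. by rewrite /revn; case: ifP; lia. Qed.

(** At an inner vertex, parity separates the two orientations of the edge: equal parity gives the
    same state, opposite parity the reverse dart at the complementary position. *)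
Lemma srcP s t : src s = src t <-> src_spec s t.
Proof.
split.
  rewrite /src; case: unliftP => [j jE|j0]; case: unliftP => [j' jE'|j0'] //.
    case=> half_eq pos_eq.
    have [odd_eq|odd_neq] := eqVneq (odd s.1) (odd t.1).
      apply: SrcSame; first by rewrite jE.
      apply: state_eq; first by lia.
      rewrite jE jE' /=; move: pos_eq; rewrite odd_eq; case: ifP => _; last by move->.
      by move/rev_ord_inj ->.
    apply: SrcRot; first by rewrite jE.
    have s2 : 0 < s.2 by rewrite jE.
    have [h1 h2] := rot_inner s2; apply: state_eq.
      by rewrite h1 /=; apply: half_eq_revn.
    rewrite h2 jE jE' !lift0; have := ltn_ord j; have := ltn_ord j'.
    move: pos_eq odd_neq; case: (odd s.1); case: (odd t.1) => //= /(congr1 val) /=; lia.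
  by case=> h; apply: SrcBranch => //; rewrite (j0, j0').
case.
- move=> s0 t0 o; have -> : s = (s.1, ord0) by apply: state_eq.
  have -> : t = (t.1, ord0) by apply: state_eq.
  by rewrite /src /= unlift_none; congr inl; apply: val_inj.
- by move=> _ ->.
move=> s0 ->; have [h1 h2] := rot_inner s0; rewrite /src.
case: unliftP => [j jE|j0]; last by rewrite j0 in s0.
case: unliftP => [j' jE'|j0']; last first.
  by move: h2; rewrite j0' /=; have := ltn_ord s.2; lia.
rewrite h1; congr inr; congr pair; first by apply: val_inj; rewrite /= half_revn.
rewrite /= odd_revn; apply: val_inj.
move: h2; rewrite jE jE' !lift0; have := ltn_ord j; have := ltn_ord j'.
by case: (odd s.1) => /=; lia.
Qed.

Lemma src_rot s : src (rot s) = src s.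
Proof.
apply/esym/srcP; have [s0|s0] := posnP s.2; last exact: SrcRot.
by apply: SrcBranch; rewrite ?rot_branch //= org_rotn.
Qed.

Lemma rot_neq s : rot s != s.
Proof.
have [s0|s0] := posnP s.2.
  rewrite rot_branch //; apply/eqP => /(congr1 (fun s => nat_of_ord s.1)) /= E.
  by have /andP[] := rotn_neq (ltn_ord s.1); rewrite E eqxx.
apply/eqP => E; have [/(congr1 val) /= h _] := rot_inner s0; move: h; rewrite E.
by move/(congr1 odd); rewrite odd_revn; case: (odd _).
Qed.

Lemma rot_inj : injective rot.
Proof.
move=> s t E; have E2 := congr1 (fun s : state => nat_of_ord s.2) E.
have E1 := congr1 (fun s : state => nat_of_ord s.1) E; move: E1 E2 => /=.
have := ltn_ord s.2; have := ltn_ord t.2.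
have [s0|s0] := posnP s.2; have [t0|t0] := posnP t.2.
- rewrite !rot_branch //= => _ _ E1 _; apply: state_eq; last by rewrite s0 t0.
  by rewrite -[LHS]rotn3 // -[RHS]rotn3 // E1.
- by have [h1 h2] := rot_inner t0; rewrite h2 (rot_branch s0) /=; lia.
- by have [h1 h2] := rot_inner s0; rewrite h2 (rot_branch t0) /=; lia.
have [-> ->] := rot_inner s0; have [-> ->] := rot_inner t0 => /= t2 s2 E1 E2.
apply: state_eq; last by lia.
by rewrite -[LHS]revnK E1 revnK.
Qed.

Lemma src_conn s t : src s = src t -> fconnect rot s t.
Proof.
case/srcP => [s0 t0 /eqP o|_ ->|_ ->]; [|exact: connect0|exact: fconnect1].
have rotE d : rot (d, ord0) = (rot0 d, ord0) by rewrite rot_branch.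
have -> : s = (s.1, ord0) by apply: state_eq.
have := org_eqP (ltn_ord s.1) (ltn_ord t.1) o; rewrite !inE => /or3P[]/eqP E.
- have -> : t = (s.1, ord0) by apply: state_eq.
  exact: connect0.
- have -> : t = (rot0 s.1, ord0) by apply: state_eq.
  by rewrite -rotE fconnect1.
have -> : t = (rot0 (rot0 s.1), ord0) by apply: state_eq.
by rewrite -!rotE; apply: (fconnect_iter rot 2).
Qed.

Lemma src_opp s : src (opp s) != src s.
Proof.
apply/eqP/srcP => -[/= h1 h2 /eqP|/= h1 E|/= h1 E].
- by rewrite (negPf (org_revn (ltn_ord s.1))).
- have /(congr1 odd) := congr1 (fun s => nat_of_ord s.1) E.
  by rewrite /= odd_revn; case: (odd _).
have [_] := rot_inner (s := opp s) h1; rewrite -E /=.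
by have := ltn_ord s.2; lia.
Qed.

Lemma dart_of_inj : injective (dart_of src opp).
Proof.
move=> s t [/srcP[s0 t0 o1|_ -> //|s0 tE] /srcP o2].
  case: o2 => /= [h1 h2 o2|h1 /(congr1 fst)|h1].
  - by apply: state_eq; [apply: org_inj | rewrite s0 t0].
  - move/(congr1 rev0)=> E; apply: state_eq; last by rewrite s0 t0.
    by have /= := congr1 val E; rewrite !revnK.
  have [h _] := rot_inner (s := opp s) h1.
  move/(congr1 (fun s => nat_of_ord s.1)); rewrite h /= revnK => E.
  by have := org_revn (ltn_ord t.1); rewrite E o1 eqxx.
have [t1 t2] := rot_inner s0; rewrite -tE in t1 t2; have := ltn_ord s.2.
case: o2 => /= [h1 h2|h1 /(congr1 fst)/(congr1 val) /=|h1].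
- by rewrite t1 /= revnK => /eqP; rewrite (negPf (org_revn (ltn_ord s.1))).
- by rewrite t1 /= => /(congr1 odd); rewrite !odd_revn; case: (odd _).
have [_ h] := rot_inner (s := opp s) h1.
move/(congr1 (fun s => nat_of_ord s.2)); rewrite h /= t2; lia.
Qed.

Lemma src_surj x : exists s, src s = x.
Proof.
case: x => [v|[a j]].
  have [d d60 dv] := org_surj (ltn_ord v).
  exists (Ordinal d60, ord0); rewrite /src unlift_none.
  by congr inl; apply: val_inj.
have a60 : a.*2 < 60 by have := ltn_ord a; lia.
exists (Ordinal a60, lift ord0 j); rewrite /src liftK /= odd_double.
by congr (inr (_, _)); apply: val_inj; rewrite /= doubleK.
Qed.

Local Notation face := (map_face rot opp).

Lemma face_last s : s.2 = r :> nat ->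
  (face s).1 = phin s.1 :> nat /\ (face s).2 = 0 :> nat.
Proof. by move=> s2; rewrite /map_face rot_branch //= s2 subnn. Qed.

Lemma face_inner s : s.2 < r ->
  (face s).1 = s.1 /\ (face s).2 = s.2.+1 :> nat.
Proof.
move=> s2; have o2 : 0 < (opp s).2 by rewrite /=; lia.
have [h1 h2] := rot_inner o2; rewrite /map_face h2 h1 /=; split; last by lia.
by apply: val_inj; rewrite /= revnK.
Qed.

Local Notation edge := (map_edge src opp).

Lemma face_inj : injective face.
Proof. by move=> s t /rot_inj/(can_inj oppK). Qed.

Lemma face_label s : face0 (face s).1 = face0 s.1.
Proof.
apply: val_inj => /=; have [s2|s2] := ltnP s.2 r; first by rewrite (face_inner s2).1.
by rewrite (face_last _).1 ?facen_phin //; have := ltn_ord s.2; lia.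
Qed.

Lemma iter_face_inner (d : 'I_60) i (i_lt : i < r.+1) :
  iter i face (d, ord0) = (d, Ordinal i_lt).
Proof.
elim: i i_lt => [|i IHi] i_lt; first by apply: state_eq.
have i_lt' : i < r.+1 by apply: ltnW.
have ir : (d, Ordinal i_lt').2 < r by [].
rewrite iterS (IHi i_lt'); case: (face_inner ir) => h1 h2.
by apply: state_eq; rewrite ?h1 ?h2.
Qed.

Lemma iter_face_start s : iter s.2 face (s.1, ord0) = s.
Proof. by rewrite (iter_face_inner _ (ltn_ord _)); apply: state_eq. Qed.

Definition face_next (d : 'I_60) := Ordinal (phin_lt (ltn_ord d)).

Lemma iter_face_edge (d : 'I_60) : iter r.+1 face (d, ord0) = (face_next d, ord0).
Proof.
rewrite iterS (iter_face_inner _ (ltnSn r)).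
have rr : (d, Ordinal (ltnSn r)).2 = r :> nat by [].
by have [h1 h2] := face_last rr; apply: state_eq; rewrite ?h1 ?h2.
Qed.

Lemma iter_face_edges (d : 'I_60) n :
  iter (n * r.+1) face (d, ord0) = (iter n face_next d, ord0).
Proof. by elim: n => // n IHn; rewrite mulSn iterD IHn iter_face_edge iterS. Qed.

Lemma val_iter_face_next n (d : 'I_60) : iter n face_next d = iter n phin d :> nat.
Proof. by elim: n => //= n ->. Qed.

(** Each state lies on the face of the start of its path, and [r.+1] face steps between starts make
    one step of [phin]; the orbits are thus those of the twelve pentagons. *)
Lemma face_labelP s t : fconnect face s t <-> face0 s.1 = face0 t.1.
Proof.
split=> [/iter_findex <-|].
  by elim: (findex _ _ _) => //= n ->; rewrite face_label.
move=> /(congr1 val)/= lab.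
have start s0 : fconnect face (s0.1, ord0) s0.
  by have := fconnect_iter face s0.2 (s0.1, ord0); rewrite iter_face_start.
apply: connect_trans (start t).
apply: (@connect_trans _ _ (s.1, ord0)); first by rewrite (fconnect_sym face_inj).
have /mapP[n _ tE] := facen_eqP (ltn_ord s.1) (ltn_ord t.1) lab.
have -> : (t.1, ord0) = iter (n * r.+1) face (s.1, ord0).
  by rewrite iter_face_edges; apply: state_eq; rewrite /= ?val_iter_face_next.
exact: fconnect_iter.
Qed.

Lemma edge_sym : symmetric edge.
Proof. by case: (map_graph_simple oppK src_opp). Qed.

Lemma edge_face s : edge (src s) (src (face s)).
Proof. by rewrite /map_face src_rot map_edge_dart. Qed.

Lemma connect_face s n : connect edge (src s) (src (iter n face s)).
Proof.
elim: n => [|n IHn]; first exact: connect0.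
by apply: connect_trans IHn _; apply: connect1; apply: edge_face.
Qed.

Lemma connected_vertices x y : connect edge x y.
Proof.
have csym := sym_connect_sym edge_sym.
suff conn z : connect edge (inl ord0) z.
  by apply: connect_trans (conn y); rewrite csym.
have [s <-] := src_surj z.
have := connect_face (s.1, ord0) s.2; rewrite iter_face_start.
apply: connect_trans.
have -> : src (s.1, ord0) = inl (org0 s.1) by rewrite /src unlift_none.
move: (org0 s.1) => {s z} v; have [n] := ubnP v; elim: n v => // n IHn v.
rewrite ltnS => vn; have [v0|v0] := posnP v.
  by rewrite (_ : v = ord0) //; apply: val_inj.
have v19 : v.-1 < 19 by have := ltn_ord v; lia.
have [d [d60 dv du]] := lower_neighbour v19; rewrite prednK // in dv du.
pose d' := Ordinal d60.
have -> : v = org0 d' by apply: val_inj.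
apply: (@connect_trans _ _ (inl (org0 (rev0 d')))); first by apply: IHn => /=; lia.
rewrite csym.
have srcE c : inl (org0 c) = src (c, ord0) by rewrite /src unlift_none.
(* The far end of [d'] is the source of the next dart of its face, so following the face crosses the
   whole path. *)
have -> : inl (org0 (rev0 d')) = src (face_next d', ord0).
  by rewrite -srcE; congr inl; apply: val_inj; rewrite /= org_rotn // revn_lt.
by rewrite srcE -iter_face_edge connect_face.
Qed.

Lemma subdivided_planar : planar edge.
Proof.
apply: (map_planar oppK rot_inj src_rot src_conn src_surj dart_of_inj
         (label := fun s => face0 s.1)); first exact: face_labelP.
  rewrite /n_components (_ : [set _ | _ in _] = [set setT]) ?cards1 //.
  apply/setP => X; rewrite inE; apply/imsetP/eqP => [[x _ ->]|->].
    by apply/setP => y; rewrite !inE connected_vertices.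
  by exists (inl ord0) => //; apply/setP => y; rewrite !inE connected_vertices.
have -> : (fun s => face0 s.1) @: [set: state] = [set: 'I_12].
  apply/setP => f; rewrite inE; have [d d60 df] := facen_surj (ltn_ord f).
  by apply/imsetP; exists (Ordinal d60, ord0) => //; apply: val_inj.
(* Euler's formula reads 2 (20 + 30 r + 12) = 4 + 60 (r + 1). *)
by rewrite cardsT card_sum !card_prod !card_ord; lia.
Qed.

(** * Walks, girth and irreducibility of the subdivision *)

Local Notation follows := (follows src opp).

Lemma follows_inner s t : follows s t -> s.2 < r -> t.1 = s.1 /\ t.2 = s.2.+1 :> nat.
Proof.
move=> /andP[/eqP/esym/srcP E st] sr; have := face_inner sr.
case: E => [/= h|_ tE|_ ->] //; first by lia.
by rewrite tE eqxx in st.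
Qed.

Lemma follows_last s t : follows s t -> s.2 = r :> nat ->
  (t.1 : nat) \in [:: phin s.1; rotn (phin s.1)] /\ t.2 = 0 :> nat.
Proof.
move=> /andP[/eqP/esym/srcP E st] sr.
have o2 : (opp s).2 = 0 :> nat by rewrite /= sr subnn.
case: E => [_ t2 /eqP E|h|h]; [|by rewrite o2 in h..].
split=> //; have := org_eqP (ltn_ord (opp s).1) (ltn_ord t.1) E.
rewrite !inE => /or3P[]/eqP tE; rewrite ?tE /phin ?eqxx ?orbT //.
by case/eqP: st; apply: state_eq; rewrite ?tE // t2 o2.
Qed.

Section Walks.
Variables (st : nat -> state) (n : nat).
Hypothesis st_follows : forall i, i < n -> follows (st i) (st i.+1).

(** Inside a path a walk can only go forward, and after its last dart the index restarts at 0. *)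
Lemma follows_index i : i <= n -> (st i).2 = ((st 0).2 + i) %% r.+1 :> nat.
Proof.
elim: i => [|i IHi] i_n; first by rewrite addn0 modn_small.
have -> : ((st 0).2 + i.+1) %% r.+1 = (st i).2.+1 %% r.+1.
  by rewrite IHi 1?ltnW // -[in RHS]addn1 modnDml addn1 addnS.
have [lt_r|ge_r] := ltnP (st i).2 r.
  by have [_ ->] := follows_inner (st_follows i_n) lt_r; rewrite modn_small.
have eq_r : (st i).2 = r :> nat by have := ltn_ord (st i).2; lia.
by have [_ ->] := follows_last (st_follows i_n) eq_r; rewrite eq_r modnn.
Qed.

Lemma follows_branch : r <= n -> exists2 j, j <= r & (st j).2 = 0 :> nat.
Proof.
move=> rn; have [s0|s0] := posnP (st 0).2; first by exists 0.
have lt_r := ltn_ord (st 0).2.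
exists (r.+1 - (st 0).2); first by lia.
by rewrite follows_index ?subnKC ?modnn //; lia.
Qed.

Lemma follows_thread : (st 0).2 = 0 :> nat -> r < n ->
  (st r.+1).2 = 0 :> nat /\
  ((st r.+1).1 : nat) \in [:: phin (st 0).1; rotn (phin (st 0).1)].
Proof.
move=> s0 rn; have thread j : j <= r -> (st j).1 = (st 0).1 /\ (st j).2 = j :> nat.
  elim: j => // j IHj jr; have [h1 h2] := IHj (ltnW jr).
  have jn : j < n by lia.
  by have [|-> ->] := follows_inner (st_follows jn); rewrite h2.
have [h1 h2] := thread r (leqnn r).
by have [] := follows_last (st_follows rn) h2; rewrite h1.
Qed.

End Walks.

Lemma follows_walks m (st : nat -> state) :
  (forall i, i < m * r.+1 -> follows (st i) (st i.+1)) -> (st 0).2 = 0 :> nat ->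
  ((st (m * r.+1)).1 : nat) \in walk_ends m (st 0).1.
Proof.
elim: m st => [|m IHm] st fol s0; first by rewrite mul0n inE.
have rn : r < m.+1 * r.+1 by rewrite mulSn; lia.
have [s1 step] := follows_thread fol s0 rn.
have := IHm (fun i => st (r.+1 + i)); rewrite addn0 mulSn => H.
have {}H : ((st (r.+1 + m * r.+1)).1 : nat) \in walk_ends m (st r.+1).1.
  by apply: H => // i im; rewrite addnS; apply: fol; rewrite mulSn; lia.
rewrite /= mem_cat; move: step; rewrite !inE => /orP[]/eqP E; rewrite E in H;
  by rewrite H ?orbT.
Qed.

Lemma cycle_nth (T : Type) (f : rel T) x0 (c : seq T) i : 0 < size c ->
  path.cycle f c -> f (nth x0 c (i %% size c)) (nth x0 c (i.+1 %% size c)).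
Proof.
case: c => // x c _; rewrite [size _]/= => /(pathP x0); rewrite size_rcons.
have lt_mod := ltn_pmod i (ltn0Sn (size c)).
move=> /(_ _ lt_mod); rewrite -rcons_cons nth_rcons /= lt_mod nth_rcons.
have -> : i.+1 %% (size c).+1 = (i %% (size c).+1).+1 %% (size c).+1.
  by rewrite -[in RHS]addn1 modnDml addn1.
move: (i %% _) lt_mod => k; rewrite ltnS leq_eqVlt => /orP[/eqP ->|lt_k].
  by rewrite ltnn eqxx modnn.
by rewrite lt_k modn_small.
Qed.

(** Read as a periodic walk started at a branch vertex, a cycle returns to index 0, so its length is
    m (r + 1), and it traces a closed nonbacktracking walk of m steps in the dodecahedron, whence m
    >= 5. *)
Lemma subdivided_girth_ge : girth_ge edge (5 * r.+1).
Proof.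
move=> c /and3P[c3 uc cyc]; set L := size c in c3 *.
have [x0 _] : exists x0 : vertex, True by exists (inl ord0).
have L0 : 0 < L by lia.
pose w i := nth x0 c (i %% L).
have w_edge i : edge (w i) (w i.+1) by apply: cycle_nth.
have w_back i : w i != w i.+2.
  rewrite nth_uniq ?ltn_pmod //; apply/eqP => /eqP.
  by rewrite -[X in X == _ %[mod _]]addn0 -addn2 eqn_modDl mod0n modn_small.
(* The [r] extra steps leave a full turn of the cycle once a branch vertex has been reached. *)
have [st [st_dart st_fol]] := map_walk (n := r + L) oppK src_surj
  (fun i _ => w_edge i) (fun i _ => w_back i).
have [|j jr sj] := follows_branch (n := r + L) st_fol; first by lia.
pose t i := st (j + i).
have t_fol i : i < L -> follows (t i) (t i.+1).
  by move=> iL; rewrite /t addnS; apply: st_fol; lia.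
have t0 : (t 0).2 = 0 :> nat by rewrite /t addn0.
have tL : t L = t 0.
  apply: dart_of_inj; rewrite /t addn0 !st_dart; [|by lia..].
  by rewrite /w -addSn !modnDr.
have := follows_index t_fol (leqnn L); rewrite tL t0 add0n => /esym/eqP/dvdnP[m Lm].
have := @follows_walks m t; rewrite -Lm tL => /(_ t_fol t0) closed.
have [m5|] := leqP 5 m; first by rewrite Lm leq_mul2r m5 orbT.
move=> m5; have m_bd : 0 < m < 5.
  by rewrite m5 andbT lt0n; apply/eqP => m0; rewrite Lm m0 in L0.
by have := no_short_walk (ltn_ord (t 0).1) m_bd; rewrite closed.
Qed.

(** The boundary of a face attains the bound; its vertices are distinct because the lower bound on
    the girth excludes a repetition within a shorter stretch. *)
Lemma subdivided_girth : girth_eq edge (5 * r.+1).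
Proof.
split; first exact: subdivided_girth_ge.
pose s0 : state := (ord0, ord0).
pose w i := src (iter i face s0).
have w_edge i : edge (w i) (w i.+1) by rewrite /w iterS edge_face.
have w_back i : w i != w i.+2.
  rewrite /w !iterS; move: (iter i face s0) => s; rewrite /map_face src_rot.
  apply/eqP => E; have /eqP[] := rot_neq (opp s).
  by apply: dart_of_inj; rewrite /dart_of oppK src_rot E.
have [_ irr] := map_graph_simple oppK src_opp.
have w_inj := nonbacktracking_inj irr subdivided_girth_ge w_edge w_back.
have closed : w (5 * r.+1) = w 0.
  by rewrite /w iter_face_edges; congr src; apply: state_eq.
have size_w : size (mkseq w (5 * r.+1)) = 5 * r.+1 by rewrite size_mkseq.
exists (mkseq w (5 * r.+1)); split=> //; apply/and3P; split.
- by rewrite size_w; lia.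
- apply/mkseq_uniqP => a b; rewrite !inE => al bl; case: (ltngtP a b) => // ab /eqP;
    last rewrite eq_sym; by rewrite (negPf (w_inj _ _ _ _)) //; lia.
have [m mE] : exists m, 5 * r.+1 = m.+1 by exists (5 * r + 4); lia.
by rewrite mE in closed *; apply: cycle_mkseq.
Qed.

Lemma deg_ge2 x : 2 <= deg_in edge [set: vertex] x.
Proof.
have [s <-] := src_surj x.
have := @map_deg _ _ src opp dart_of_inj [:: s; rot s] s; apply=> /=.
  by rewrite inE eq_sym rot_neq.
by move=> t; rewrite !inE => /orP[]/eqP ->; rewrite ?src_rot.
Qed.

Lemma deg_branch s : s.2 = 0 :> nat -> 3 <= deg_in edge [set: vertex] (src s).
Proof.
move=> s0; have := @map_deg _ _ src opp dart_of_inj [:: s; rot s; rot (rot s)] s.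
apply=> /=; last first.
  by move=> t; rewrite !inE => /or3P[]/eqP ->; rewrite ?src_rot.
have rot2_neq : rot (rot s) != s.
  rewrite !rot_branch //; apply/eqP => /(congr1 (fun s => nat_of_ord s.1)) /= E.
  by have /andP[_] := rotn_neq (ltn_ord s.1); rewrite E eqxx.
rewrite !inE negb_or [s == rot s]eq_sym [s == rot (rot s)]eq_sym.
by rewrite [rot s == rot (rot s)]eq_sym !rot_neq rot2_neq.
Qed.

(** An ear of length at least r+2 has at least r+1 internal vertices, and r+1 consecutive vertices
    of a nonbacktracking walk include a branch vertex. *)
Lemma subdivided_irreducible S' : ~ p_reduction edge r.+2 setT S'.
Proof.
case=> [[x _ [deg1 _]]|[x [y [mid [[us pth _ deg2 size_mid] _]]]]].
  by move: deg1; rewrite leqNgt deg_ge2.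
pose w i := nth x (x :: rcons mid y) i.
have size_us : size (x :: rcons mid y) = (size mid).+2 by rewrite /= size_rcons.
have w_edge i : i <= size mid -> edge (w i) (w i.+1).
  by move=> im; move/pathP: pth => /(_ x i); rewrite size_rcons; apply.
have w_back i : i < size mid -> w i != w i.+2.
  by move=> im; rewrite nth_uniq // ?size_us; lia.
have [st [st_dart st_fol]] := map_walk oppK src_surj w_edge w_back.
(* The shift by one starts the search at the first internal vertex. *)
have [i ir|//|j jr sj] := @follows_branch (fun i => st i.+1) r.
  by apply: st_fol; lia.
have jm : j < size mid by lia.
have [wj _] := st_dart j.+1 jm.
have := deg_branch sj; rewrite wj.
have w_mid : w j.+1 \in mid by rewrite /w /= nth_rcons jm mem_nth.
by rewrite (eqP (allP deg2 _ w_mid)).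
Qed.

Lemma subdivided_not_degenerate : ~ path_degenerate edge r.+2.
Proof.
rewrite /path_degenerate => H; inversion H as [E|S S' red _ E].
  by have := in_set0 (inl ord0 : vertex); rewrite E inE.
exact: subdivided_irreducible red.
Qed.

End SubdividedDodecahedron.

Theorem mainTheorem8 (p : nat) (hp : 2 <= p) :
  (forall (T : finType) (e : rel T),
      simple_graph e -> planar e -> girth_ge e (5 * p - 4) ->
      path_degenerate e p)
  /\
  (exists (T : finType) (e : rel T),
      [/\ simple_graph e, planar e, girth_eq e (5 * p - 5)
        & ~ path_degenerate e p]).
Proof.
split=> [T e|]; first exact: planar_path_degenerate.
(* A path of length p-1 has p-2 inner vertices. *)
pose r := p - 2; have pE : p = r.+2 by rewrite /r; lia.
exists ('I_20 + 'I_30 * 'I_r)%type, (map_edge (@src r) (@opp r)).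
have -> : 5 * p - 5 = 5 * r.+1 by lia.
rewrite pE; split.
- exact: map_graph_simple (@oppK r) (@src_opp r).
- exact: subdivided_planar.
- exact: subdivided_girth.
- exact: subdivided_not_degenerate.
Qed.
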